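(* Let $q\ge1$ and let $D:n\to n$ be a $\mathrm{PBS}_q$-diagram. Then $\llbracket D\rrbracket$ is the linear map given by $|c,p,x\rangle\mapsto|\tau_D(c,p)\rangle\otimes[D]_{c,p}|x\rangle$ for all $c\in\{\rightarrow,\uparrow\}$, $p\in[n]$, $x\in[q]$, where $\tau_D(c,p)$ and $[D]_{c,p}$ are the (unique) elements such that $(D,c,p)\xRightarrow{[D]_{c,p}}\tau_D(c,p)$.
   Context: Fix an integer $q\ge 1$; write $[n]=\{0,\dots,n-1\}$. Syntax. $\mathrm{PBS}_q$-terms, each of a type $n\to n$ ($n\in\mathbb N$), are generated by: the empty diagram $\varepsilon:0\to0$, the wire $\mathrm{id}:1\to1$, the negation $\neg:1\to1$, the swap $\sigma:2\to2$, the polarising beam splitter $\beta:2\to2$, a gate $\gamma_U:1\to1$ for each $U\in\mathbb C^{q\times q}$; sequential composition $D_2\circ D_1:n\to n$ for $D_1,D_2:n\to n$; parallel composition $D_1\otimes D_2:n+m\to n+m$ for $D_1:n\to n$, $D_2:m\to m$; trace $Tr(D):n\to n$ for $D:n+1\to n+1$. A congruence is a type-preserving equivalence relation on terms compatible with $\circ$, $\otimes$ and $Tr$. Let $I_0=\varepsilon$, $I_{k+1}=I_k\otimes\mathrm{id}$; $\sigma_{1,0}=\mathrm{id}$, $\sigma_{1,k+1}=(I_k\otimes\sigma)\circ(\sigma_{1,k}\otimes\mathrm{id})$; $Tr_0(D)=D$, $Tr_{k+1}(D)=Tr(Tr_k(D))$. Diagrams are terms modulo the structural congruence, the smallest congruence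 containing all well-typed instances of: $(D_3\circ D_2)\circ D_1=D_3\circ(D_2\circ D_1)$; $I_k\circ D=D=D\circ I_k$; $\varepsilon\otimes D=D=D\otimes\varepsilon$; $(D_1\otimes D_2)\otimes D_3=D_1\otimes(D_2\otimes D_3)$; $(D_3\circ D_1)\otimes(D_4\circ D_2)=(D_3\otimes D_4)\circ(D_1\otimes D_2)$; $\sigma_{1,k}\circ(\mathrm{id}\otimes D)=(D\otimes\mathrm{id})\circ\sigma_{1,k}$ for $D:k\to k$; $\sigma\circ\sigma=I_2$; $Tr(D_1\otimes D_2)=D_1\otimes Tr(D_2)$; $Tr(D_2\circ(D_1\otimes\mathrm{id}))=Tr(D_2)\circ D_1$; $Tr((D_2\otimes\mathrm{id})\circ D_1)=D_2\circ Tr(D_1)$; $Tr_k((I_n\otimes D_2)\circ D_1)=Tr_k(D_1\circ(I_n\otimes D_2))$ for $D_2:k\to k$, $D_1:n+k\to n+k$; $Tr(\sigma)=\mathrm{id}$. Path semantics. For $D:n\to n$, $c,c'\in\{\rightarrow,\uparrow\}$, $p,p'\in[n]$, $U\in\mathbb C^{q\times q}$, the judgement $(D,c,p)\xRightarrow{U}(c',p')$ (the label is omitted when $U$ is the identity) is defined inductively by: $(\mathrm{id},c,0)\Rightarrow(c,0)$; $(\neg,\uparrow,0)\Rightarrow(\rightarrow,0)$; $(\neg,\rightarrow,0)\Rightarrow(\uparrow,0)$; $(\gamma_U,c,0)\xRightarrow{U}(c,0)$; $(\sigma,c,p)\Rightarrow(c,1-p)$; $(\beta,\rightarrow,p)\Rightarrow(\rightarrow,p)$;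 $(\beta,\uparrow,p)\Rightarrow(\uparrow,1-p)$; if $(D_1,c,p)\xRightarrow{U}(c',p')$ and $(D_2,c',p')\xRightarrow{V}(c'',p'')$ then $(D_2\circ D_1,c,p)\xRightarrow{VU}(c'',p'')$; for $D_1:n\to n$, if $p<n$ and $(D_1,c,p)\xRightarrow{U}(c',p')$ then $(D_1\otimes D_2,c,p)\xRightarrow{U}(c',p')$, and if $p\ge n$ and $(D_2,c,p-n)\xRightarrow{U}(c',p')$ then $(D_1\otimes D_2,c,p)\xRightarrow{U}(c',p'+n)$; for $k\in\{0,1,2\}$, $D:n+1\to n+1$ and $p_0\in[n]$, if $(D,c_i,p_i)\xRightarrow{U_i}(c_{i+1},p_{i+1})$ for all $i\in\{0,\dots,k\}$, and for all such $i$ one has $p_{i+1}=n$ if and only if $i<k$, then $(Tr(D),c_0,p_0)\xRightarrow{U_k\cdots U_0}(c_{k+1},p_{k+1})$. For each $D:n\to n$ and $(c,p)$ there are unique $(c',p')$ and $U$ with $(D,c,p)\xRightarrow{U}(c',p')$ (independently of the term representing $D$); one writes $\tau_D(c,p)=(c',p')$ and $[D]_{c,p}=U$. Denotational semantics. $\mathcal H_n=\mathbb C^{\{\rightarrow,\uparrow\}}\otimes\mathbb C^n\otimes\mathbb C^q$ with orthonormal basis $|c,p,x\rangle$, $c\in\{\rightarrow,\uparrow\}$, $p\in[n]$, $x\in[q]$. The linear map $\llbracket D\rrbracket:\mathcal H_n\to\mathcal H_n$ for $D:n\to n$ is defined inductively: $\llbracket\varepsilon\rrbracket=0$; $\llbracket\mathrm{id}\rrbracket$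 is the identity; $\llbracket\neg\rrbracket$ exchanges $|\rightarrow,0,x\rangle$ and $|\uparrow,0,x\rangle$; $\llbracket\sigma\rrbracket|c,p,x\rangle=|c,1-p,x\rangle$; $\llbracket\beta\rrbracket|\rightarrow,p,x\rangle=|\rightarrow,p,x\rangle$, $\llbracket\beta\rrbracket|\uparrow,p,x\rangle=|\uparrow,1-p,x\rangle$; $\llbracket\gamma_U\rrbracket|c,0,x\rangle=|c,0\rangle\otimes U|x\rangle$; $\llbracket D_2\circ D_1\rrbracket=\llbracket D_2\rrbracket\circ\llbracket D_1\rrbracket$; $\llbracket D_1\otimes D_2\rrbracket=\llbracket D_1\rrbracket\boxplus\llbracket D_2\rrbracket$, where for $f$ on $\mathcal H_n$ and $g$ on $\mathcal H_m$, $f\boxplus g$ on $\mathcal H_{n+m}$ is $f\oplus g$ transported along the isomorphism $\mathcal H_n\oplus\mathcal H_m\cong\mathcal H_{n+m}$ sending $|c,p,x\rangle$ of the first summand to $|c,p,x\rangle$ and $|c,p,x\rangle$ of the second to $|c,p+n,x\rangle$; $\llbracket Tr(D)\rrbracket=\mathcal T(\llbracket D\rrbracket)$, where for $f$ on $\mathcal H_{n+1}$, $\mathcal T(f)=\sum_{k\in\mathbb N}\pi_1\circ(f\circ\pi_0)^k\circ f\circ\iota$ with $\iota:\mathcal H_n\to\mathcal H_{n+1}$ the inclusion $|c,p,x\rangle\mapsto|c,p,x\rangle$, $\pi_0:\mathcal H_{n+1}\to\mathcal H_{n+1}$ killing basis vectors with $p<n$ and fixing those with $p=n$, $\pi_1:\mathcal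 H_{n+1}\to\mathcal H_n$ sending $|c,p,x\rangle$ to itself if $p<n$ and to $0$ if $p=n$. (For maps arising from diagrams the sum has finitely many nonzero terms.) *)

(* Defs.v *)
From HB Require Import structures.
From mathcomp Require Import all_boot all_order all_algebra.
From mathcomp Require Import boolp classical_sets fsbigop reals complex.

Set Implicit Arguments.
Unset Strict Implicit.
Unset Printing Implicit Defensive.

Import GRing.Theory.
Local Open Scope ring_scope.
Local Open Scope quotient_scope.

Inductive dir := Right | Up.

Definition dir_flip (c : dir) : dir := if c is Right then Up else Right.

Definition bool_of_dir (c : dir) : bool := if c is Up then true else false.
Definition dir_of_bool (b : bool) : dir := if b then Up else Right.
Lemma bool_of_dirK : cancel bool_of_dir dir_of_bool.
Proof. by case. Qed.
HB.instance Definition _ := Finite.copy dir (can_type bool_of_dirK).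

(* Everything is parametrised by the scalar field [F]; the intended field is
   that of the complex numbers. *)

Inductive term (F : fieldType) (q : nat) : nat -> Type :=
| Empty : term F q 0
| Wire : term F q 1
| Neg : term F q 1
| Swap : term F q 2
| Pbs : term F q 2
| Gate of 'M[F]_q : term F q 1
| Seq n : term F q n -> term F q n -> term F q n (* [Seq D2 D1] is D2 o D1 *)
| Par n m : term F q n -> term F q m -> term F q (n + m)
| Tr n : term F q n.+1 -> term F q n.

Arguments Empty {F q}.
Arguments Wire {F q}.
Arguments Neg {F q}.
Arguments Swap {F q}.
Arguments Pbs {F q}.
Arguments Gate {F q} U.

(* Types such as [n + 1] and [n.+1] are equal but not convertible. *)
Definition tcast (F : fieldType) (q m n : nat) (e : m = n) (D : term F q m) :
  term F q n := ecast k (term F q k) e D.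

(* The identity I_k. *)
Fixpoint wires (F : fieldType) (q k : nat) : term F q k :=
  match k with
  | 0 => Empty
  | k'.+1 => tcast (addn1 k') (Par (wires F q k') Wire)
  end.

(* sigma_{1,k}: moves wire 0 past k wires. *)
Fixpoint swap1 (F : fieldType) (q k : nat) : term F q k.+1 :=
  match k with
  | 0 => Wire
  | k'.+1 => Seq (tcast (addn2 k') (Par (wires F q k') Swap))
                 (tcast (addn1 k'.+1) (Par (swap1 F q k') Wire))
  end.

(* Tr_k: traces out the last k of n + k wires. *)
Fixpoint trace_iter (F : fieldType) (q k n : nat) :
    term F q (n + k) -> term F q n :=
  match k with
  | 0 => fun D => tcast (addn0 n) D
  | k'.+1 => fun D =>
      Tr (@trace_iter F q k' n.+1 (tcast (esym (addSnnS n k')) D))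
  end.

Inductive scong (F : fieldType) (q : nat) :
    forall n, term F q n -> term F q n -> Prop :=
| sc_refl n (D : term F q n) : scong D D
| sc_sym n (D D' : term F q n) : scong D D' -> scong D' D
| sc_trans n (D D' D'' : term F q n) :
    scong D D' -> scong D' D'' -> scong D D''
| sc_seq n (D1 D1' D2 D2' : term F q n) :
    scong D1 D1' -> scong D2 D2' -> scong (Seq D2 D1) (Seq D2' D1')
| sc_par n m (D1 D1' : term F q n) (D2 D2' : term F q m) :
    scong D1 D1' -> scong D2 D2' -> scong (Par D1 D2) (Par D1' D2')
| sc_tr n (D D' : term F q n.+1) : scong D D' -> scong (Tr D) (Tr D')
| sc_seqA n (D1 D2 D3 : term F q n) :
    scong (Seq (Seq D3 D2) D1) (Seq D3 (Seq D2 D1))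
| sc_seq1l n (D : term F q n) : scong (Seq (wires F q n) D) D
| sc_seq1r n (D : term F q n) : scong D (Seq D (wires F q n))
| sc_par0l n (D : term F q n) : scong (Par Empty D) D
| sc_par0r n (D : term F q n) : scong D (tcast (addn0 n) (Par D Empty))
| sc_parA n m k (D1 : term F q n) (D2 : term F q m) (D3 : term F q k) :
    scong (Par (Par D1 D2) D3) (tcast (addnA n m k) (Par D1 (Par D2 D3)))
| sc_interchange n m (D1 D3 : term F q n) (D2 D4 : term F q m) :
    scong (Par (Seq D3 D1) (Seq D4 D2)) (Seq (Par D3 D4) (Par D1 D2))
| sc_swap_nat k (D : term F q k) :
    scong (Seq (swap1 F q k) (Par Wire D))
          (Seq (tcast (addn1 k) (Par D Wire)) (swap1 F q k))
| sc_swapK : scong (Seq Swap Swap) (wires F q 2)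
| sc_superpose n m (D1 : term F q n) (D2 : term F q m.+1) :
    scong (Tr (tcast (addnS n m) (Par D1 D2))) (Par D1 (Tr D2))
| sc_tightenr n (D1 : term F q n) (D2 : term F q n.+1) :
    scong (Tr (Seq D2 (tcast (addn1 n) (Par D1 Wire)))) (Seq (Tr D2) D1)
| sc_tightenl n (D1 : term F q n.+1) (D2 : term F q n) :
    scong (Tr (Seq (tcast (addn1 n) (Par D2 Wire)) D1)) (Seq D2 (Tr D1))
| sc_sliding n k (D1 : term F q (n + k)) (D2 : term F q k) :
    scong (trace_iter (Seq (Par (wires F q n) D2) D1))
          (trace_iter (Seq D1 (Par (wires F q n) D2)))
| sc_yank : scong (Tr Swap) Wire.

HB.instance Definition _ (F : fieldType) (q n : nat) := gen_eqMixin (term F q n).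
HB.instance Definition _ (F : fieldType) (q n : nat) :=
  gen_choiceMixin (term F q n).

Definition scongb (F : fieldType) (q n : nat) : rel (term F q n) :=
  fun D D' => `[< scong D D' >].

Lemma scongb_refl (F : fieldType) (q n : nat) : reflexive (@scongb F q n).
Proof. by move=> D; apply/asboolP; exact: sc_refl. Qed.
Lemma scongb_sym (F : fieldType) (q n : nat) : symmetric (@scongb F q n).
Proof. by move=> D D'; apply/asboolP/asboolP; exact: sc_sym. Qed.
Lemma scongb_trans (F : fieldType) (q n : nat) : transitive (@scongb F q n).
Proof.
by move=> D' D D'' /asboolP h /asboolP h'; apply/asboolP; exact: sc_trans h h'.
Qed.

Canonical scong_equiv (F : fieldType) (q n : nat) : equiv_rel (term F q n) :=
  EquivRel (@scongb F q n) (@scongb_refl F q n) (@scongb_sym F q n)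
    (@scongb_trans F q n).

Definition diagram (F : fieldType) (q n : nat) : Type :=
  {eq_quot (@scong_equiv F q n)}.

Definition config (n : nat) : Type := (dir * 'I_n)%type.

Definition config_widen (n : nat) (s : config n) : config n.+1 :=
  (s.1, widen_ord (leqnSn n) s.2).

Inductive pbs_path (F : fieldType) (q : nat) :
    forall n, term F q n -> config n -> 'M[F]_q -> config n -> Prop :=
| path_wire c : pbs_path Wire (c, ord0) 1%:M (c, ord0)
| path_neg_up : pbs_path Neg (Up, ord0) 1%:M (Right, ord0)
| path_neg_right : pbs_path Neg (Right, ord0) 1%:M (Up, ord0)
| path_gate (U : 'M[F]_q) c : pbs_path (Gate U) (c, ord0) U (c, ord0)
(* On ['I_2], [rev_ord p] is 1 - p. *)
| path_swap c p : pbs_path Swap (c, p) 1%:M (c, rev_ord p)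
| path_pbs_right p : pbs_path Pbs (Right, p) 1%:M (Right, p)
| path_pbs_up p : pbs_path Pbs (Up, p) 1%:M (Up, rev_ord p)
| path_seq n (D1 D2 : term F q n) (U V : 'M[F]_q) s s' s'' :
    pbs_path D1 s U s' -> pbs_path D2 s' V s'' ->
    pbs_path (Seq D2 D1) s (V *m U) s''
| path_parl n m (D1 : term F q n) (D2 : term F q m) U c p c' p' :
    pbs_path D1 (c, p) U (c', p') ->
    pbs_path (Par D1 D2) (c, lshift m p) U (c', lshift m p')
| path_parr n m (D1 : term F q n) (D2 : term F q m) U c p c' p' :
    pbs_path D2 (c, p) U (c', p') ->
    pbs_path (Par D1 D2) (c, rshift n p) U (c', rshift n p')
(* [s i] is the i-th configuration (c_i, p_i) of the run, for i <= k.+1. *)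
| path_tr n (D : term F q n.+1) (k : nat) (s : nat -> config n.+1)
    (U : nat -> 'M[F]_q) (s0 s1 : config n) :
    (k <= 2)%N ->
    s 0%N = config_widen s0 -> s k.+1 = config_widen s1 ->
    (forall i, (i <= k)%N -> pbs_path D (s i) (U i) (s i.+1)) ->
    (forall i, (i <= k)%N -> (s i.+1).2 = n :> nat <-> (i < k)%N) ->
    pbs_path (Tr D) s0 (\big[mulmx/1%:M]_(i <- rev (iota 0 k.+1)) U i) s1.

Definition dpath (F : fieldType) (q n : nat) (D : diagram F q n)
    (s : config n) (U : 'M[F]_q) (s' : config n) : Prop :=
  exists2 t : term F q n, \pi_(diagram F q n) t = D & pbs_path t s U s'.

(* tau_D and [D]: chosen jointly, with a default value when no path exists. *)
Definition dpath_result (F : fieldType) (q n : nat) (D : diagram F q n)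
    (s : config n) : config n * 'M[F]_q :=
  xget (s, 1%:M) [set r : config n * 'M[F]_q | dpath D s r.2 r.1]%classic.

Definition tau (F : fieldType) (q n : nat) (D : diagram F q n) (s : config n) :
  config n := (dpath_result D s).1.

Definition dmatrix (F : fieldType) (q n : nat) (D : diagram F q n)
  (s : config n) : 'M[F]_q := (dpath_result D s).2.

(* F^{dir} (x) F^n (x) F^q, as the space of coordinate families in the basis
   |c, p, x>. *)
Definition hspace (F : fieldType) (q n : nat) : Type :=
  {ffun config n * 'I_q -> F^o}.

(* |c, p> (x) v *)
Definition tens (F : fieldType) (q n : nat) (s : config n) (v : 'cV[F]_q) :
  hspace F q n := [ffun b => if b.1 == s then v b.2 ord0 else 0].

Definition qket (F : fieldType) (q : nat) (x : 'I_q) : 'cV[F]_q :=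
  delta_mx x ord0.

Definition ket (F : fieldType) (q n : nat) (s : config n) (x : 'I_q) :
  hspace F q n := tens s (qket F x).

(* The linear map sending |c, p, x> to [f (c, p) x]. *)
Definition linext (F : fieldType) (q n m : nat)
    (f : config n -> 'I_q -> hspace F q m) : 'Hom(hspace F q n, hspace F q m) :=
  linfun (fun v : hspace F q n => \sum_b (v b : F) *: f b.1 b.2).

(* f (+) g, transported along H_n (+) H_m ~ H_(n+m). *)
Definition hsum (F : fieldType) (q n m : nat)
    (f : 'End(hspace F q n)) (g : 'End(hspace F q m)) :
    'End(hspace F q (n + m)) :=
  let inl_ := linext (fun s x => ket F (s.1, lshift m s.2) x) in
  let inr_ := linext (fun s x => ket F (s.1, rshift n s.2) x) in
  linext (fun s x => match split s.2 with
                     | inl p => inl_ (f (ket F (s.1, p) x))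
                     | inr p => inr_ (g (ket F (s.1, p) x))
                     end).

Definition hincl (F : fieldType) (q n : nat) :
    'Hom(hspace F q n, hspace F q n.+1) :=
  linext (fun s x => ket F (config_widen s) x).

Definition hproj0 (F : fieldType) (q n : nat) : 'End(hspace F q n.+1) :=
  linext (fun s x => if (s.2 < n)%N then 0 else ket F s x).

Definition hproj1 (F : fieldType) (q n : nat) :
    'Hom(hspace F q n.+1, hspace F q n) :=
  linext (fun s x => if insub (val s.2) is Some p then ket F (s.1, p) x else 0).

(* The sum over all k is the sum of its nonzero terms; it takes the value 0
   when infinitely many terms are nonzero, which no diagram produces. *)
Definition htrace (F : fieldType) (q n : nat) (f : 'End(hspace F q n.+1)) :
    'End(hspace F q n) :=
  \sum_(k \in [set: nat]%classic)
    (hproj1 F q n \o iter k (fun g => (f \o hproj0 F q n) \o g) \1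
       \o f \o hincl F q n)%VF.

Fixpoint tdenote (F : fieldType) (q n : nat) (D : term F q n) :
    'End(hspace F q n) :=
  match D in term _ _ k return 'End(hspace F q k) with
  | Empty => 0
  | Wire => \1%VF
  | Neg => linext (fun s x => ket F (dir_flip s.1, s.2) x)
  | Swap => linext (fun s x => ket F (s.1, rev_ord s.2) x)
  | Pbs => linext (fun s x => ket F (s.1, if s.1 is Up then rev_ord s.2
                                          else s.2) x)
  | Gate U => linext (fun s x => tens s (U *m qket F x))
  | Seq _ D2 D1 => (tdenote D2 \o tdenote D1)%VF
  | Par _ _ D1 D2 => hsum (tdenote D1) (tdenote D2)
  | Tr _ D1 => htrace (tdenote D1)
  end.

(* Independent of the representative, as congruent terms have equal
   denotations. *)
Definition denote (F : fieldType) (q n : nat) (D : diagram F q n) :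
  'End(hspace F q n) := tdenote (repr D).

(* Main.v *)
(* Forgetting the bounds on positions, a term becomes a relation between states
   in {Right, Up} x nat labelled by matrices; this absorbs the type casts and
   turns every structural congruence axiom into an equality of relations, with
   the k-fold trace being the relation of runs whose intermediate positions all
   lie on traced wires. These relations are total, deterministic and injective
   in their end state. By injectivity a run through a single trace visits each
   of the two states of the traced wire at most once, which both gives totality
   of the trace and makes all terms of index >= 3 of the series for the
   denotation of the trace vanish. *)

From HB Require Import structures.
Require Import Defs.
From mathcomp Require Import all_boot all_order all_algebra.
From mathcomp Require Import boolp classical_sets reals complex.
From mathcomp Require Import fsbigop zify.

Import GRing.Theory.
Local Open Scope ring_scope.
Local Open Scope quotient_scope.

(** * Labelled relations on states with unbounded positions, and their operations *)

Definition npos : Type := (dir * nat)%type.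

Definition wrel (F : fieldType) (q : nat) : Type :=
  npos -> 'M[F]_q -> npos -> Prop.

Definition shift (n : nat) (s : npos) : npos := (s.1, n + s.2)%N.

Section WeightedRelations.
Context {F : fieldType} {q : nat}.
Implicit Types (P Q : wrel F q) (U V W : 'M[F]_q) (n m k : nat) (s t : npos).

Lemma wrel_ext P Q : (forall s U s', P s U s' <-> Q s U s') -> P = Q.
Proof.
by move=> PQ; do 3!(apply/funext => ?); apply/propext.
Qed.

Definition rid n : wrel F q := fun s U s' => [/\ (s.2 < n)%N, U = 1%:M & s' = s].

Definition rseq Q P : wrel F q := fun s W s'' =>
  exists s' U V, [/\ P s U s', Q s' V s'' & W = V *m U].

Definition roffset n P : wrel F q := fun s U s' =>
  exists t t', [/\ s = shift n t, s' = shift n t' & P t U t'].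

(** The left block is not cut off at position [n]; the two blocks are kept apart by assuming
    [bounded n P] where it matters. *)
Definition rpar n P Q : wrel F q := fun s U s' => P s U s' \/ roffset n Q s U s'.

(* [run P n] only constrains where a run may stop; its start is constrained to
   positions below [n] in [rtr], which keeps inductions on runs unrestricted. *)
Inductive run P n : wrel F q :=
| run_exit s U s' : P s U s' -> (s'.2 < n)%N -> run P n s U s'
| run_step s U s1 V s' : P s U s1 -> (n <= s1.2)%N -> run P n s1 V s' ->
    run P n s (V *m U) s'.

(** The number of traced wires does not appear: if [P] lives on [n + k] wires, this traces out the
    last [k] at once. *)
Definition rtr n P : wrel F q := fun s U s' => (s.2 < n)%N /\ run P n s U s'.

Definition bounded n P :=
  forall s U s', P s U s' -> (s.2 < n)%N /\ (s'.2 < n)%N.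
Definition total_on n P := forall s, (s.2 < n)%N -> exists U s', P s U s'.
Definition det P := forall s U s' V t', P s U s' -> P s V t' -> U = V /\ s' = t'.
(** Labels are left free, so a gate is injective in this sense even when its matrix is singular. *)
Definition inj P := forall s U s' t V, P s U s' -> P t V s' -> s = t.

Lemma shift_inj n : injective (shift n).
Proof. by move=> [c p] [d r] [-> /addnI ->]. Qed.

Lemma shiftD n m s : shift (n + m) s = shift n (shift m s).
Proof. by rewrite /shift /= addnA. Qed.

Lemma shiftP n s : (n <= s.2)%N -> exists t, s = shift n t.
Proof. by case: s => c p /= np; exists (c, p - n)%N; rewrite /shift /= subnKC. Qed.

Lemma run_lt P n s U s' : run P n s U s' -> (s'.2 < n)%N.
Proof. by elim. Qed.

(** * Boundedness, and the axioms for sequential and parallel composition *)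

Lemma rid_bounded n : bounded n (rid n).
Proof. by move=> s U s' [lt_sn _ ->]. Qed.

Lemma rseq_bounded n P Q : bounded n P -> bounded n Q -> bounded n (rseq Q P).
Proof. by move=> bP bQ s W s'' [s' [U [V [/bP[lt_s _] /bQ[_ lt_s''] _]]]]. Qed.

Lemma rpar_bounded n m P Q :
  bounded n P -> bounded m Q -> bounded (n + m) (rpar n P Q).
Proof.
move=> bP bQ s U s' [/bP|[t [t' [-> -> /bQ]]]] /=; first by case; lia.
by rewrite !ltn_add2l.
Qed.

Lemma rtr_bounded n P : bounded n (rtr n P).
Proof. by move=> s U s' [lt_sn /run_lt]. Qed.

Lemma rseqA P1 P2 P3 : rseq (rseq P3 P2) P1 = rseq P3 (rseq P2 P1).
Proof.
apply: wrel_ext => s W s'; split.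
  move=> [s1 [U [VW [P1s [s2 [V [W' [P2s P3s ->]]]] ->]]]].
  exists s2, (V *m U), W'; split; rewrite ?mulmxA //.
  by exists s1, U, V.
move=> [s2 [VU [W' [[s1 [U [V [P1s P2s ->]]]] P3s ->]]]].
exists s1, U, (W' *m V); split; rewrite ?mulmxA //.
by exists s2, V, W'.
Qed.

Lemma rseq1l n P : bounded n P -> rseq (rid n) P = P.
Proof.
move=> bP; apply: wrel_ext => s W s'; split.
  by move=> [s1 [U [V [Ps [_ -> ->] ->]]]]; rewrite mul1mx.
move=> Ps; exists s', W, 1%:M; rewrite mul1mx; split=> //.
by split=> //; case: (bP _ _ _ Ps).
Qed.

Lemma rseq1r n P : bounded n P -> rseq P (rid n) = P.
Proof.
move=> bP; apply: wrel_ext => s W s'; split.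
  by move=> [s1 [U [V [[_ -> ->] Ps ->]]]]; rewrite mulmx1.
move=> Ps; exists s, 1%:M, W; rewrite mulmx1; split=> //.
by split=> //; case: (bP _ _ _ Ps).
Qed.

Lemma rpar0l P : rpar 0 (rid 0) P = P.
Proof.
apply: wrel_ext => s U s'; split.
  by move=> [[]//|[[c p] [[c' p'] [-> -> //]]]].
by move=> Ps; right; exists s, s'; split=> //; [case: s {Ps} | case: s' {Ps}].
Qed.

Lemma rpar0r n P : rpar n P (rid 0) = P.
Proof.
apply: wrel_ext => s U s'; split; last by left.
by move=> [//|[t [t' [_ _ []]]]].
Qed.

Lemma rparA n m P1 P2 P3 :
  rpar (n + m) (rpar n P1 P2) P3 = rpar n P1 (rpar m P2 P3).
Proof.
apply: wrel_ext => s U s'; split.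
  move=> [[Ps|[t [t' [-> -> Pt]]]]|[t [t' [-> -> Pt]]]]; first by left.
    by right; exists t, t'; split=> //; left.
  right; exists (shift m t), (shift m t'); split; rewrite ?shiftD //.
  by right; exists t, t'.
move=> [Ps|[t [t' [-> -> [Pt|[u [u' [-> -> Pu]]]]]]]].
- by left; left.
- by left; right; exists t, t'.
- by right; exists u, u'; split; rewrite ?shiftD.
Qed.

(** Boundedness keeps a state in its block, so a step in one block followed by a step in the other
    is contradictory. *)
Lemma rpar_seq n P1 P2 P3 P4 : bounded n P1 -> bounded n P3 ->
  rpar n (rseq P3 P1) (rseq P4 P2) = rseq (rpar n P3 P4) (rpar n P1 P2).
Proof.
move=> b1 b3; apply: wrel_ext => s W s'; split.
  move=> [[s1 [U [V [? ? ?]]]]|].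
    by exists s1, U, V; split=> //; left.
  move=> [t [t' [-> -> [t1 [U [V [? ? ?]]]]]]].
  exists (shift n t1), U, V; split=> //; right; first by exists t, t1.
  by exists t1, t'.
move=> [s1 [U [V [+ + eW]]]].
move=> [P1s|[t [t1 [-> -> Pt]]]] [P3s|[u [t' [e -> Pu]]]].
- by left; exists s1, U, V.
- by have [_] := b1 _ _ _ P1s; rewrite e /=; lia.
- by have [] := b3 _ _ _ P3s => /=; lia.
- rewrite -(shift_inj _ _ _ e) in Pu.
  by right; exists t, t'; split=> //; exists t1, U, V.
Qed.

Lemma rpar_rid n m : rpar n (rid n) (rid m) = rid (n + m).
Proof.
apply: wrel_ext => s U s'; split.
  move=> [[lt_sn -> ->]|[t [t' [-> -> [lt_tm -> ->]]]]].
    by split=> //; lia.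
  by split=> //=; lia.
move=> [lt_s -> ->]; have [lt_sn|/shiftP[t e]] := ltnP s.2 n; first by left.
by right; exists t, t; split=> //; split=> //; move: lt_s; rewrite e /=; lia.
Qed.

(** * The axioms for the trace *)

(** A run that may stop only below [n] is cut at its visits to positions below [m]; its pieces are
    the runs of the inner trace. *)
Lemma rtr_rtr n m P : (n <= m)%N -> rtr n (rtr m P) = rtr n P.
Proof.
move=> le_nm; apply: wrel_ext => s U s'; split=> -[lt_sn rP]; split=> //.
  (* A finished inner run either stops below [n] and is an outer run, or can be prepended to an
     outer run. *)
  have cat_run u V u1 : run P m u V u1 ->
      ((u1.2 < n)%N -> run P n u V u1) /\
      (forall W u', (n <= u1.2)%N -> run P n u1 W u' -> run P n u (W *m V) u').
    elim=> [{}u {}V {}u1 Pu lt_um | {}u {}V v W {}u1 Pu le_mv rv [IHl IHr]].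
      split=> [lt_un|W u' le_nu ru]; first exact: run_exit Pu lt_un.
      exact: run_step Pu le_nu ru.
    have le_nv := leq_trans le_nm le_mv.
    split=> [lt_un|W' u' le_nu ru]; first exact: run_step Pu le_nv (IHl lt_un).
    by rewrite mulmxA; exact: run_step Pu le_nv (IHr _ _ le_nu ru).
  elim: rP {lt_sn} => [u V u' [_ ru] lt_u'|u V v W u' [_ ru] le_nv _ IH].
    exact: (cat_run _ _ _ ru).1.
  exact: (cat_run _ _ _ ru).2.
have lt_sm : (s.2 < m)%N by lia.
(* Conversely, a step landing below [m] is an inner run by itself, and any other step is glued to
   the front of the next inner run. The bounds on the starts of inner runs are restored
   afterwards. *)
have {lt_sn}: run (run P m) n s U s'.
  elim: rP {lt_sm lt_sn} => [u V u' Pu lt_u'|u V v W u' Pu le_nv _ IH].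
    by apply: run_exit (lt_u'); apply: run_exit Pu _; lia.
  have [lt_vm|le_mv] := ltnP v.2 m.
    by apply: run_step le_nv IH; exact: run_exit Pu lt_vm.
  case: IH Pu le_mv {le_nv} => [{}v {}W {}u' rv lt_u' Pu le_mv
                     |{}v {}W v1 W' {}u' rv le_nv1 ru Pu le_mv].
    by apply: run_exit lt_u'; exact: run_step Pu le_mv rv.
  by rewrite -mulmxA; apply: run_step le_nv1 ru; exact: run_step Pu le_mv rv.
move=> ru; elim: ru lt_sm => [u V u' ru lt_u' lt_u|u V v W u' ru le_nv _ IH lt_u].
  exact: run_exit.
by apply: run_step le_nv (IH (run_lt _ _ _ _ _ ru)); split.
Qed.

(** The case of no traced wire: a bounded [P] never reaches a position from which a run would go
    on. *)
Lemma rtr_id n P : bounded n P -> rtr n P = P.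
Proof.
move=> bP; apply: wrel_ext => s U s'; split=> [[_]|Ps].
  by case=> // {}s V s1 W {}s' /bP[_]; lia.
by have [? ?] := bP _ _ _ Ps; split=> //; exact: run_exit.
Qed.

(** A run entering the left block exits after one step, since [P] stays below [n]; a run in the
    right block stays there and is a shifted run of [Q]. *)
Lemma rtr_superpose n m P Q : bounded n P ->
  rtr (n + m) (rpar n P Q) = rpar n P (rtr m Q).
Proof.
move=> bP; apply: wrel_ext => s U s'; split.
  move=> [lt_s r].
  have: P s U s' \/ roffset n (run Q m) s U s'.
    elim: r {lt_s} => [u V u' [Pu|[t [t' [-> -> Qt]]]] lt_u'
               |u V v W u' [Pu|[t [t' [-> -> Qt]]]] le_v _ IH].
    - by left.
    - right; exists t, t'; split=> //; apply: run_exit Qt _.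
      by move: lt_u'; rewrite ltn_add2l.
    - by have [] := bP _ _ _ Pu; lia.
    - case: IH => [/bP[/=]|]; first by lia.
      move=> [t1 [t1' [/shift_inj <- -> rt]]].
      right; exists t, t1'; split=> //; apply: run_step Qt _ rt.
      by move: le_v; rewrite leq_add2l.
  case=> [Ps|[t [t' [es -> rt]]]]; [by left | right; exists t, t'; split=> //].
  by split=> //; move: lt_s; rewrite es ltn_add2l.
move=> [Ps|[t [t' [-> -> [lt_t rt]]]]].
  have [? ?] := bP _ _ _ Ps; split; first by lia.
  by apply: run_exit; [left | lia].
split; first by rewrite ltn_add2l.
elim: rt {lt_t} => [u V u' Qu lt_u'|u V v W u' Qu le_v _ IH].
  apply: run_exit; last by rewrite ltn_add2l.
  by right; exists u, u'.
apply: run_step IH; last by rewrite leq_add2l.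
by right; exists u, v.
Qed.

Lemma rpar_ltE n P Q s U s' : (s.2 < n)%N -> rpar n P Q s U s' -> P s U s'.
Proof. by move=> lt_s [//|[t [t' [e _ _]]]]; rewrite e /= in lt_s; lia. Qed.

Lemma rpar_geE n P Q s U s' : bounded n P -> (n <= s.2)%N ->
  rpar n P Q s U s' -> roffset n Q s U s'.
Proof. by move=> bP ge_s [/bP[]|//]; lia. Qed.

Lemma roffset_rid n m s U s' : roffset n (rid m) s U s' -> U = 1%:M /\ s' = s.
Proof. by move=> [t [t' [-> -> [_ -> ->]]]]. Qed.

Lemma rpar_rid_ge n m P s : (n <= s.2 < n + m)%N -> rpar n P (rid m) s 1%:M s.
Proof.
move=> /andP[/shiftP[t ->]]; rewrite ltn_add2l => lt_t.
by right; exists t, t; split.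
Qed.

Lemma rpar_rid_geE n m P s U s' : bounded n P -> (n <= s.2)%N ->
  rpar n P (rid m) s U s' -> U = 1%:M /\ s' = s.
Proof. by move=> bP ge_s /(rpar_geE _ _ _ _ _ _ bP ge_s)/roffset_rid. Qed.

Lemma rpar_out_ltE n P Q s U s' : bounded n P -> (s'.2 < n)%N ->
  rpar n P Q s U s' -> P s U s'.
Proof. by move=> bP lt_s' [//|[t [t' [_ e _]]]]; rewrite e /= in lt_s'; lia. Qed.

(** After the first step every step starts on the traced wire, where [rpar n P (rid 1)] is the
    identity; hence [P] acts only once, at the start. *)
Lemma rtr_tightenr n P Q : bounded n P -> bounded n.+1 Q ->
  rtr n (rseq Q (rpar n P (rid 1))) = rseq (rtr n Q) P.
Proof.
move=> bP bQ; apply: wrel_ext => s W s'; split.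
  move=> [lt_s r].
  have [V [t [W' [Ps rt ->]]]] : exists V t W',
      [/\ rpar n P (rid 1) s V t, run Q n t W' s' & W = W' *m V].
    elim: r {lt_s} => [u X u' [t [V [W' [Pu Qt ->]]]] lt_u'
              |u X v Y u' [t [V [W' [Pu Qt ->]]]] le_v _ IH].
      by exists V, t, W'; split=> //; exact: run_exit.
    have [V1 [t1 [W1 [/(rpar_rid_geE _ _ _ _ _ _ bP le_v)[-> ->] rt1 ->]]]] := IH.
    exists V, t, (W1 *m W'); split=> //; last by rewrite mulmx1 mulmxA.
    exact: run_step Qt le_v rt1.
  have {}Ps := rpar_ltE _ _ _ _ _ _ lt_s Ps.
  exists t, V, W'; split=> //; split=> //.
  by case: (bP _ _ _ Ps).
move=> [t [V [W' [Ps [lt_t rt] ->]]]].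
split; first by case: (bP _ _ _ Ps).
have {Ps}: rpar n P (rid 1) s V t by left.
elim: rt s V {lt_t} => [u X u' Qu lt_u'|u X v Y u' Qu le_v _ IH] s V Ps.
  by apply: run_exit lt_u'; exists u, V, X.
(* The inserted factor 1 is the label of the identity wire crossed at the start of the next step. *)
rewrite -mulmxA -(mulmx1 Y); apply: (run_step _ _ _ _ v) => //.
  by exists u, V, X.
apply: IH; apply: rpar_rid_ge.
by have [] := bQ _ _ _ Qu; lia.
Qed.

(** Dually, [Q] acts only on the exit step, all earlier steps ending on the traced wire. *)
Lemma rtr_tightenl n P Q : bounded n Q -> bounded n.+1 P ->
  rtr n (rseq (rpar n Q (rid 1)) P) = rseq Q (rtr n P).
Proof.
move=> bQ bP; apply: wrel_ext => s W s'; split.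
  move=> [lt_s r].
  have [t [U [V [rs Qt ->]]]] : exists t U V,
      [/\ run P n s U t, Q t V s' & W = V *m U].
    elim: r {lt_s} => [u X u' [t [V [W' [Pu Qt ->]]]] lt_u'
              |u X v Y u' [t [V [W' [Pu Qt ->]]]] le_v _ [t' [U1 [V1 [rv Qt' ->]]]]].
      have {}Qt := rpar_out_ltE _ _ _ _ _ _ bQ lt_u' Qt.
      exists t, V, W'; split=> //; apply: run_exit Pu _.
      by case: (bQ _ _ _ Qt).
    have [lt_t|le_t] := ltnP t.2 n.
      by have [] := bQ _ _ _ (rpar_ltE _ _ _ _ _ _ lt_t Qt); lia.
    have [-> e] := rpar_rid_geE _ _ _ _ _ _ bQ le_t Qt.
    exists t', (U1 *m V), V1; split=> //; last by rewrite mul1mx mulmxA.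
    by apply: run_step Pu le_t _; rewrite -e.
  by exists t, U, V.
move=> [t [U [V [[lt_s rs] Qt ->]]]]; split=> //.
elim: rs Qt {lt_s} => [u X u' Pu lt_u'|u X v Y u' Pu le_v _ IH] Qt.
  apply: run_exit; last by case: (bQ _ _ _ Qt).
  by exists u', X, V; split=> //; left.
rewrite mulmxA; apply: run_step (IH Qt) => //.
exists v, X, 1%:M; rewrite mul1mx; split=> //.
by apply: rpar_rid_ge; have [] := bP _ _ _ Pu; lia.
Qed.

(** [R] is the identity below [n] and preserves the set of traced positions. Regrouping a run
    therefore moves [R] from the end of each step to the start of the next, and nothing is left over
    at either end. *)
Lemma rtr_slide n k P Q : bounded (n + k) P -> bounded k Q ->
  rtr n (rseq (rpar n (rid n) Q) P) = rtr n (rseq P (rpar n (rid n) Q)).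
Proof.
move=> bP bQ; set R := rpar n (rid n) Q.
have R_lt s : (s.2 < n)%N -> R s 1%:M s by left.
have R_ltE s U s' : R s U s' -> (s.2 < n)%N -> U = 1%:M /\ s' = s.
  by move=> Rs lt_s; have [] := rpar_ltE _ _ _ _ _ _ lt_s Rs.
have R_ltE' s U s' : R s U s' -> (s'.2 < n)%N -> U = 1%:M /\ s' = s.
  move=> Rs lt_s'.
  by have [] := rpar_out_ltE _ _ _ _ _ _ (rid_bounded n) lt_s' Rs.
have R_ge s U s' : R s U s' -> (n <= s.2)%N = (n <= s'.2)%N.
  move=> Rs; have [lt_s|le_s] := ltnP s.2 n.
    by have [_ ->] := R_ltE _ _ _ Rs lt_s; lia.
  have [lt_s'|//] := ltnP s'.2 n.
  by have [_ e] := R_ltE' _ _ _ Rs lt_s'; rewrite e in lt_s'; lia.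
apply: wrel_ext => s W s'; split=> -[lt_s r]; split=> //.
  (* The induction carries a pending [R]: the new run starts at any [z] that [R] sends, with label
     [Z], to the start of the old one. The wanted case is [z = s] with label 1. *)
  rewrite -(mulmx1 W); move: {lt_s}(R_lt _ lt_s).
  elim: r {1 3}s 1%:M => [t X u' [u [U [V [Pt Ru ->]]]] lt_u'
             |t X t1 Y u' [u [U [V [Pt Ru ->]]]] le_t1 _ IH] z Z Rz.
    have [-> ->] := R_ltE' _ _ _ Ru lt_u'; rewrite mul1mx.
    apply: run_exit; last by have [_ <-] := R_ltE' _ _ _ Ru lt_u'.
    by exists t, Z, U.
  rewrite !mulmxA -mulmxA; apply: run_step (IH _ _ Ru).
    by exists t, Z, U.
  by rewrite (R_ge _ _ _ Ru).
(* In the other direction the first [R] is split off, and it is trivial because [s] lies below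
   [n]. *)
have [t [V [W' [Rs rt ->]]]] : exists t V W',
    [/\ R s V t, run (rseq R P) n t W' s' & W = W' *m V].
  elim: r {lt_s} => [u X u' [t [V [U [Ru Pt ->]]]] lt_u'
          |u X u1 Y u' [t [V [U [Ru Pt ->]]]] le_u1 _ [t1 [V1 [W1 [Ru1 rt1 ->]]]]].
    exists t, V, U; split=> //; apply: run_exit (lt_u').
    by exists u', U, 1%:M; rewrite mul1mx; split=> //; exact: R_lt.
  exists t, V, (W1 *m (V1 *m U)); split; rewrite ?mulmxA //.
  rewrite -mulmxA; apply: run_step rt1; last by rewrite -(R_ge _ _ _ Ru1).
  by exists u1, U, V1.
by move: rt; have [-> ->] := R_ltE _ _ _ Rs lt_s; rewrite mulmx1.
Qed.

(** * Determinism, injectivity and totality of the trace *)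

Lemma run_det P n : det P -> det (run P n).
Proof.
move=> dP s U s' V t' r; elim: r V t' => {s U s'} [s U s' Ps lt_s'
  |s U s1 W s' Ps le_s1 _ IH] V t' rt.
  case: rt Ps => [{}s {}V {}t' Pt lt_t' /dP/(_ Pt)//|].
  move=> {}s {}V t1 Y {}t' Pt le_t1 _ /dP/(_ Pt)[_ e].
  by move: le_t1; rewrite -e; lia.
case: rt Ps => [{}s {}V {}t' Pt lt_t' /dP/(_ Pt)[_ e]|].
  by move: lt_t'; rewrite -e; lia.
move=> {}s {}V t1 Y {}t' Pt le_t1 rt /dP/(_ Pt)[-> e].
by rewrite -e in rt; have [-> ->] := IH _ _ rt.
Qed.

(* Runs extended at their end, so that injectivity can be used backwards. *)
Inductive inner P n (s : npos) : npos -> Prop :=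
| inner_nil : inner P n s s
| inner_rcons u V v : inner P n s u -> P u V v -> (n <= v.2)%N -> inner P n s v.

Lemma run_inner P n s U s' : run P n s U s' ->
  exists u V, inner P n s u /\ P u V s'.
Proof.
elim=> {s U s'} [s U s' Ps _|s U s1 W s' Ps le_s1 _ [u [V [iu Pu]]]].
  by exists s, U; split=> //; exact: inner_nil.
exists u, V; split=> //.
elim: iu => [|v X w _ iv Pv le_w].
  by apply: inner_rcons Ps le_s1; exact: inner_nil.
exact: inner_rcons iv Pv le_w.
Qed.

(** Injectivity walks both inner runs backwards in parallel. They become empty together, because
    starts lie below [n] and all later states do not. *)
Lemma inner_inj P n s t u : inj P -> (s.2 < n)%N -> (t.2 < n)%N ->
  inner P n s u -> inner P n t u -> s = t.
Proof.
move=> iP lt_s lt_t; elim=> [it|v X w _ IH Pv le_w it].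
  by case: it lt_s => // v X w _ _; lia.
case: it Pv le_w => [|v' X' {}w it Pv' _ Pv le_w]; first by lia.
by apply: IH; rewrite (iP _ _ _ _ _ Pv Pv').
Qed.

Lemma rtr_inj P n : inj P -> inj (rtr n P).
Proof.
move=> iP s U s' t V [lt_s /run_inner[u [X [iu Pu]]]].
move=> [lt_t /run_inner[v [Y [iv Pv]]]].
by rewrite (iP _ _ _ _ _ Pu Pv) in iu; exact: inner_inj iu iv.
Qed.

(** The constructors match the values 0, 1, 2 of [k] in [path_tr]. *)
Inductive short_run P n : wrel F q :=
| short_run1 s0 U0 s1 : P s0 U0 s1 -> (s1.2 < n)%N -> short_run P n s0 U0 s1
| short_run2 s0 U0 s1 U1 s2 : P s0 U0 s1 -> P s1 U1 s2 ->
    s1.2 = n -> (s2.2 < n)%N -> short_run P n s0 (U1 *m U0) s2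
| short_run3 s0 U0 s1 U1 s2 U2 s3 : P s0 U0 s1 -> P s1 U1 s2 -> P s2 U2 s3 ->
    s1.2 = n -> s2.2 = n -> (s3.2 < n)%N ->
    short_run P n s0 (U2 *m U1 *m U0) s3.

Lemma short_run_run P n s U s' : short_run P n s U s' -> run P n s U s'.
Proof.
case=> {s U s'} [s0 U0 s1 P0 lt_s1|s0 U0 s1 U1 s2 P0 P1 e1 lt_s2
  |s0 U0 s1 U1 s2 U2 s3 P0 P1 P2 e1 e2 lt_s3]; first exact: run_exit.
  by apply: run_step P0 _ (run_exit _ _ _ _ _ P1 lt_s2); rewrite e1.
apply: run_step P0 _ (run_step _ _ _ _ _ _ _ P1 _ (run_exit _ _ _ _ _ P2 lt_s3)).
  by rewrite e1.
by rewrite e2.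
Qed.

(* Only two states lie on the traced wire, and by injectivity a run cannot come
   back to a state it has left, so it enters the wire at most twice. *)
Lemma short_run_total P n s : bounded n.+1 P -> total_on n.+1 P -> inj P ->
  (s.2 < n)%N -> exists U s', short_run P n s U s'.
Proof.
move=> bP tP iP lt_s.
have next t : (t.2 < n.+1)%N ->
    exists U t', P t U t' /\ ((t'.2 < n)%N \/ t'.2 = n).
  move=> lt_t; have [U [t' Pt]] := tP _ lt_t; exists U, t'; split=> //.
  by have [_] := bP _ _ _ Pt; lia.
have [|U0 [s1 [P0 [lt_s1|e1]]]] := next s; first by lia.
  by exists U0, s1; exact: short_run1.
have [|U1 [s2 [P1 [lt_s2|e2]]]] := next s1; first by lia.
  by exists (U1 *m U0), s2; exact: short_run2 P0 P1 e1 lt_s2.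
have [|U2 [s3 [P2 [lt_s3|e3]]]] := next s2; first by lia.
  by exists (U2 *m U1 *m U0), s3; exact: short_run3 P0 P1 P2 e1 e2 lt_s3.
have ne12 : s1 <> s2.
  by move=> e; rewrite -e in P1; rewrite (iP _ _ _ _ _ P0 P1) in lt_s; lia.
have ne13 : s1 <> s3.
  by move=> e; rewrite -e in P2; rewrite (iP _ _ _ _ _ P0 P2) in lt_s; lia.
have ne23 : s2 <> s3.
  by move=> e; rewrite -e in P2; exact: ne12 (iP _ _ _ _ _ P1 P2).
case: s1 s2 s3 e1 e2 e3 ne12 ne13 ne23 {P0 P1 P2} => [c1 p1] [c2 p2] [c3 p3] /=.
by move=> -> -> ->; case: c1 c2 c3 => [] [] [].
Qed.

(** Some short run leaves [s]; being a run, it has the label and end of the given one by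
    determinism. *)
Lemma run_short P n s U s' : bounded n.+1 P -> total_on n.+1 P -> det P -> inj P ->
  rtr n P s U s' -> short_run P n s U s'.
Proof.
move=> bP tP dP iP [lt_s r].
have [V [t' sr]] := short_run_total _ _ _ bP tP iP lt_s.
by have [-> ->] := run_det _ _ dP _ _ _ _ _ r (short_run_run _ _ _ _ _ sr).
Qed.

End WeightedRelations.

(** * Evaluation of terms as labelled relations *)

Section Evaluation.
Context {F : fieldType} {q : nat}.
Implicit Types (U V W : 'M[F]_q) (n m k : nat).

Definition rpure n (f : npos -> npos) : wrel F q :=
  fun s U s' => [/\ (s.2 < n)%N, U = 1%:M & s' = f s].

Definition rgate U0 : wrel F q := fun s U s' => [/\ s.2 = 0%N, U = U0 & s' = s].

Definition rswap : wrel F q := rpure 2 (fun s => (s.1, 1 - s.2)%N).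

Fixpoint ev n (D : term F q n) : wrel F q :=
  match D with
  | Defs.Empty => rid 0
  | Wire => rid 1
  | Neg => rpure 1 (fun s => (dir_flip s.1, s.2))
  | Swap => rswap
  | Pbs => rpure 2 (fun s => (s.1, if s.1 is Up then 1 - s.2 else s.2)%N)
  | Gate U => rgate U
  | Seq _ D2 D1 => rseq (ev _ D2) (ev _ D1)
  | Par n _ D1 D2 => rpar n (ev _ D1) (ev _ D2)
  | Tr n D1 => rtr n (ev _ D1)
  end.
Arguments ev {n}.

Lemma ev_tcast m n (e : m = n) (D : term F q m) : ev (Defs.tcast e D) = ev D.
Proof. by case: n / e. Qed.

Lemma ev_bounded n (D : term F q n) : bounded n (ev D).
Proof.
elim: D => {n} /= [|||||U|n D2 b2 D1 b1|n m D1 b1 D2 b2|n D1 b1].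
- exact: rid_bounded.
- exact: rid_bounded.
- by move=> s U s' [? _ ->].
- by move=> s U s' [? _ ->] /=; lia.
- by move=> [[] p] U s' [/= ? _ ->] /=; lia.
- by move=> s V s' [e _ ->]; rewrite e.
- exact: rseq_bounded.
- exact: rpar_bounded.
- exact: rtr_bounded.
Qed.

Lemma ev_det n (D : term F q n) : det (ev D).
Proof.
elim: D => {n} /= [|||||U0|n D2 d2 D1 d1|n m D1 d1 D2 d2|n D1 d1] s U s' V t';
  try by move=> [_ -> ->] [_ -> ->].
- move=> [s1 [U1 [V1 [e1 e2 ->]]]] [t1 [U2 [V2 [f1 f2 ->]]]].
  have [<- es] := d1 _ _ _ _ _ e1 f1; rewrite -es in f2.
  by have [<- <-] := d2 _ _ _ _ _ e2 f2.
- move=> [e1|[t [s1 [-> -> e2]]]] [f1|[t1 [s2 [es -> f2]]]].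
  + exact: d1 e1 f1.
  + by have [] := ev_bounded _ _ _ _ _ e1; rewrite es /=; lia.
  + by have [/=] := ev_bounded _ _ _ _ _ f1; lia.
  + rewrite -(shift_inj _ _ _ es) in f2.
    by have [-> ->] := d2 _ _ _ _ _ e2 f2.
- by move=> [_ r] [_ r']; exact: run_det r r'.
Qed.

Lemma ev_inj n (D : term F q n) : inj (ev D).
Proof.
elim: D => {n} /= [|||||U0|n D2 i2 D1 i1|n m D1 i1 D2 i2|n D1 i1] s U s' t V.
- by move=> [_ _ ->] [_ _ ->].
- by move=> [_ _ ->] [_ _ ->].
- by case: s t => [[] p] [[] r] [_ _ ->] [_ _ []] // ->.
- case: s t => [c p] [d r] [/= ? _ ->] [/= ? _ [-> ?]].
  by congr (_, _); lia.
- case: s t => [[] p] [[] r] [/= ? _ ->] [/= ? _ []] // ?.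
    by congr (_, _).
  by congr (_, _); lia.
- by move=> [_ _ ->] [_ _ ->].
- move=> [s1 [U1 [V1 [e1 e2 _]]]] [t1 [U2 [V2 [f1 f2 _]]]].
  by rewrite -(i2 _ _ _ _ _ e2 f2) in f1; exact: i1 e1 f1.
- move=> [e1|[s1 [s2 [-> es e2]]]] [f1|[t1 [t2 [-> et f2]]]].
  + exact: i1 e1 f1.
  + by have [_] := ev_bounded _ _ _ _ _ e1; rewrite et /=; lia.
  + by have [_] := ev_bounded _ _ _ _ _ f1; rewrite es /=; lia.
  + rewrite es in et; rewrite -(shift_inj _ _ _ et) in f2.
    by rewrite (i2 _ _ _ _ _ e2 f2).
- exact: rtr_inj.
Qed.

Lemma ev_total n (D : term F q n) : total_on n (ev D).
Proof.
elim: D => {n} /= [|||||U|n D2 t2 D1 t1|n m D1 t1 D2 t2|n D1 t1] s lt_s;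
  try by do 2!eexists; split; first exact: lt_s.
- by exists U, s; split=> //; lia.
- have [U [s' e1]] := t1 _ lt_s; have [_ lt_s'] := ev_bounded _ _ _ _ _ e1.
  by have [V [s'' e2]] := t2 _ lt_s'; exists (V *m U), s'', s', U, V.
- have [/t1[U [s' e1]]|/shiftP[t e]] := ltnP s.2 n; first by exists U, s'; left.
  have [|U [t' e2]] := t2 t; first by rewrite e ltn_add2l in lt_s.
  by exists U, (shift n t'); right; exists t, t'.
- have [U [s' r]] := short_run_total _ _ _ (ev_bounded _ D1) t1 (ev_inj _ D1) lt_s.
  by exists U, s'; split=> //; exact: short_run_run.
Qed.

Lemma ev_tr_short n (D : term F q n.+1) s U s' :
  ev (Tr D) s U s' -> short_run (ev D) n s U s'.
Proof. exact: run_short (ev_bounded _ D) (ev_total _ D) (ev_det _ D) (ev_inj _ D). Qed.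

(** * Invariance of the evaluation under structural congruence *)

Lemma ev_wires k : ev (wires F q k) = rid k.
Proof. by elim: k => //= k IH; rewrite ev_tcast /= IH rpar_rid addn1. Qed.

Lemma ev_swap1 k : ev (swap1 F q k) =
  rpure k.+1 (fun s => (s.1, if s.2 is p.+1 then p else k)).
Proof.
elim: k => [|k IH] /=.
  apply: wrel_ext => -[c p] U s'; split=> -[/= lt_p -> ->]; split=> //=.
    by case: p lt_p.
  by case: p lt_p.
rewrite !ev_tcast /= IH ev_wires.
apply: wrel_ext => s W s'; split.
  move=> [s1 [U [V [+ + ->]]]].
  move=> [[lt_s -> ->]|[t [t' [-> -> [/= lt_t -> ->]]]]]
    [[/= lt_s1 -> ->]|[u [u' [e -> [lt_u -> ->]]]]]; rewrite mul1mx; split=> //.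
  - by lia.
  - by case: s lt_s lt_s1 => c [|p] //= *; lia.
  - by lia.
  - case: s u lt_s lt_u e => c [|p] [d r] /= lt_s lt_u [-> ?];
      rewrite /shift /=; congr (_, _); lia.
  - by lia.
  - by lia.
  - by rewrite /=; lia.
  - case: t u e lt_t lt_u => c p [d r] /= [-> ?] ? ?.
    by rewrite /shift /= ?addSn /=; congr (_, _); lia.
case: s => c p [/= lt_p -> ->].
(* Position 0 first reaches [k] and is then raised to [k.+1] by the last swap, which lowers position
   [k.+1] to [k]; the other positions only meet the smaller [swap1]. *)
have [lt_pk|le_kp] := ltnP p k.+1.
  exists (c, if p is r.+1 then r else k), 1%:M, 1%:M; rewrite mul1mx; split=> //.
    by left.
  case: p lt_p lt_pk => [|p] _ lt_p.
    right; exists (c, 0%N), (c, 1%N); split=> //; rewrite /shift /= ?addn0 ?addn1 //.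
  by left.
have -> : p = k.+1 by lia.
exists (c, k.+1), 1%:M, 1%:M; rewrite mul1mx; split=> //.
  by right; exists (c, 0%N), (c, 0%N); rewrite /shift /= addn0.
by right; exists (c, 1%N), (c, 0%N); split=> //; rewrite /shift /= ?addn0 ?addn1.
Qed.

(** Each outer trace keeps fewer wires than the one inside it, so [rtr_rtr] absorbs it. *)
Lemma ev_trace_iter k n (D : term F q (n + k)) :
  ev (trace_iter D) = rtr n (ev D).
Proof.
elim: k n D => [|k IH] n D /=.
  rewrite ev_tcast rtr_id // => s U s' /ev_bounded; by rewrite addn0.
by rewrite IH ev_tcast rtr_rtr.
Qed.

Lemma ev_scong n (D D' : term F q n) : scong D D' -> ev D = ev D'.
Proof.
elim=> {n D D'} /=.
- by [].
- by [].
- by move=> n D D' D'' _ -> _ ->.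
- by move=> n D1 D1' D2 D2' _ -> _ ->.
- by move=> n m D1 D1' D2 D2' _ -> _ ->.
- by move=> n D D' _ ->.
- by move=> n D1 D2 D3; exact: rseqA.
- by move=> n D; rewrite ev_wires rseq1l //; exact: ev_bounded.
- by move=> n D; rewrite ev_wires rseq1r //; exact: ev_bounded.
- by move=> n D; rewrite rpar0l.
- by move=> n D; rewrite ev_tcast /= rpar0r.
- by move=> n m k D1 D2 D3; rewrite ev_tcast /= rparA.
- by move=> n m D1 D3 D2 D4; apply: rpar_seq; exact: ev_bounded.
(* Naturality of the swap: the start lies either on wire 0, which goes to [k], or on a wire of [D],
   which moves down by one. *)
- move=> k D; rewrite ev_tcast ev_swap1 /=.
  apply: wrel_ext => s W s'; split.
    move=> [s1 [U [V [+ [_ -> ->] ->]]]]; rewrite mul1mx.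
    move=> [[lt_s -> ->]|[t [t' [-> -> e]]]].
      exists (s.1, k), 1%:M, 1%:M; rewrite mul1mx; case: s lt_s => c [] //= _.
      by split=> //; right; exists (c, 0%N), (c, 0%N); rewrite /shift /= addn0.
    have [lt_t lt_t'] := ev_bounded _ _ _ _ _ e.
    exists t, 1%:M, U; rewrite mulmx1; split=> //.
      by split=> //; case: (t).
    by left; case: (t') e.
  move=> [s1 [U [V [[lt_s -> ->] + ->]]]]; rewrite mulmx1.
  case: s lt_s => c [|p] /= lt_p.
    move=> [/ev_bounded[/=]|[t [t' [e -> [lt_t -> ->]]]]]; first by lia.
    exists (c, 0%N), 1%:M, 1%:M; rewrite mul1mx -e; split=> //; last by left.
  move=> [e|[t [t' [[_ e] _ [lt_t _ _]]]]]; last by lia.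
  have [_ lt_s'] := ev_bounded _ _ _ _ _ e.
  exists (shift 1 s'), V, 1%:M; rewrite mul1mx; split=> //.
    by right; exists (c, p), s'.
  by split; case: (s') lt_s'.
- rewrite -[RHS]/(ev (wires F q 2)) ev_wires; apply: wrel_ext => -[c p] W s'; split.
    move=> [s1 [U [V [[/= lt_p -> ->] [/= _ -> ->] ->]]]].
    by rewrite mul1mx; split=> //; congr (_, _); lia.
  move=> [/= lt_p -> ->]; exists (c, 1 - p)%N, 1%:M, 1%:M; rewrite mul1mx.
  by split=> //; split=> //=; [lia | congr (_, _); lia].
- move=> n m D1 D2; rewrite ev_tcast /= rtr_superpose //; exact: ev_bounded.
- move=> n D1 D2; rewrite ev_tcast /= rtr_tightenr //; exact: ev_bounded.
- move=> n D1 D2; rewrite ev_tcast /= rtr_tightenl //; exact: ev_bounded.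
- move=> n k D1 D2; rewrite !ev_trace_iter /= ev_wires; apply: rtr_slide;
    exact: ev_bounded.
(* Yanking: the swap sends 0 to the traced position 1 and, on the second pass, back to 0.
   Determinism shows that this is the only run. *)
- have loop c : run rswap 1 (c, 0%N) 1%:M (c, 0%N).
    rewrite -[X in run _ _ _ X](mulmx1 1%:M).
    by apply: (run_step _ _ _ _ (c, 1%N)) => //; exact: run_exit.
  apply: wrel_ext => -[c [|p]] W s'; split=> -[] // _; last first.
    by move=> -> ->; split=> //; exact: loop.
  by move=> /(run_det _ _ (ev_det _ Swap) _ _ _ _ _ (loop c))[<- <-].
Qed.

End Evaluation.

(** * The evaluation agrees with the path semantics *)

Section PathsAndDenotations.
Context {F : fieldType} {q : nat}.
Implicit Types (U V W : 'M[F]_q) (n m k : nat).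

(** With the bound dropped, a configuration and its widening have convertible images. *)
Definition npos_of {n} (s : config n) : npos := (s.1, val s.2).

Lemma npos_of_inj n : injective (@npos_of n).
Proof. by move=> [c p] [d r] [-> /val_inj ->]. Qed.

Lemma npos_ofP n (s : npos) : (s.2 < n)%N -> exists s' : config n, s = npos_of s'.
Proof. by case: s => c p lt_p; exists (c, Ordinal lt_p). Qed.

Lemma pbs_path_ev n (D : term F q n) s U s' :
  pbs_path D s U s' -> ev _ D (npos_of s) U (npos_of s').
Proof.
elim=> {n D s U s'} /=.
- by [].
- by [].
- by [].
- by [].
- by move=> c p; split=> //=; congr (_, _); have := ltn_ord p; lia.
- by move=> p; split=> //=.
- by move=> p; split=> //=; congr (_, _); have := ltn_ord p; lia.
- by move=> n D1 D2 U V s s' s'' _ e1 _ e2; exists (npos_of s'), U, V.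
- by move=> n m D1 D2 U c p c' p' _ e1; left.
- move=> n m D1 D2 U c p c' p' _ e2; right.
  by exists (npos_of (c, p)), (npos_of (c', p')).
move=> n D k s U s0 s1 le_k2 es0 es1 _ ev_s in_s; split; first exact: (ltn_ord s0.2).
have -> : npos_of s0 = npos_of (s 0%N) by rewrite es0.
have -> : npos_of s1 = npos_of (s k.+1) by rewrite es1.
have exit_s : ((npos_of (s k.+1)).2 < n)%N by rewrite es1 /=.
have in_n i : (i < k)%N -> (npos_of (s i.+1)).2 = n.
  by move=> lt_ik; apply/(in_s i (ltnW lt_ik)).
(* Each value of [k] gives one constructor of [short_run]; the reversed product puts the latest
   label on the left. *)
case: k le_k2 es1 ev_s in_s exit_s in_n => [|[|[|//]]] _ _ ev_s _ exit_s in_n;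
  rewrite /rev /= !big_cons big_nil ?mulmx1 ?mulmxA; apply: short_run_run.
- exact: short_run1 (ev_s 0%N isT) exit_s.
- exact: short_run2 (ev_s 0%N isT) (ev_s 1%N isT) (in_n 0%N isT) exit_s.
- exact: short_run3 (ev_s 0%N isT) (ev_s 1%N isT) (ev_s 2%N isT)
    (in_n 0%N isT) (in_n 1%N isT) exit_s.
Qed.

Lemma ev_pbs_path n (D : term F q n) s U z :
  ev _ D (npos_of s) U z -> exists2 s', z = npos_of s' & pbs_path D s U s'.
Proof.
elim: D s U z => {n} /=.
- by move=> [c []].
- move=> [c p] U z [_ -> ->]; exists (c, p) => //.
  by rewrite (ord1 p); exact: path_wire.
- move=> [c p] U z [_ -> ->]; rewrite (ord1 p); exists (dir_flip c, ord0) => //.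
  by case: c; [exact: path_neg_right | exact: path_neg_up].
- move=> [c p] U z [_ -> ->]; exists (c, rev_ord p); last exact: path_swap.
  by congr (_, _) => /=; have := ltn_ord p; lia.
- move=> [[] p] U z [_ -> ->].
    by exists (Right, p) => //; exact: path_pbs_right.
  exists (Up, rev_ord p); last exact: path_pbs_up.
  by congr (_, _) => /=; have := ltn_ord p; lia.
- move=> U [c p] V z [_ -> ->]; exists (c, p) => //.
  by rewrite (ord1 p); exact: path_gate.
- move=> n D2 IH2 D1 IH1 s W z [s1 [U [V [e1 e2 ->]]]].
  have [t es1 p1] := IH1 _ _ _ e1; rewrite es1 in e2.
  have [t' ez p2] := IH2 _ _ _ e2; exists t' => //; exact: path_seq p1 p2.
- move=> n m D1 IH1 D2 IH2 [c p] U z; case: (split_ordP p) => r ->.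
    have lt_r : ((npos_of (c, lshift m r)).2 < n)%N := ltn_ord r.
    move=> /(rpar_ltE _ _ _ _ _ _ lt_r)/(IH1 (c, r))[[c' r'] -> p1].
    by exists (c', lshift m r') => //; exact: path_parl.
  have ge_r : (n <= (npos_of (c, rshift n r)).2)%N := leq_addr r n.
  move=> /(rpar_geE _ _ _ _ _ _ (ev_bounded _ D1) ge_r).
  move=> [t [t' [et -> e]]]; rewrite -[npos_of _]/(shift n (npos_of (c, r))) in et.
  rewrite -(shift_inj _ _ _ et) in e.
  have [[c' r'] -> p2] := IH2 (c, r) _ _ e.
  by exists (c', rshift n r') => //; exact: path_parr.
move=> n D IH s0 U z /ev_tr_short.
have step (t t' : npos) (V : 'M[F]_q) (s : config n.+1) : ev _ D t V t' ->
    t = npos_of s -> exists2 s', t' = npos_of s' & pbs_path D s V s'.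
  by move=> e et; rewrite et in e; exact: IH e.
have last_in (t : npos) (s : config n.+1) : (t.2 < n)%N -> t = npos_of s ->
    exists2 s' : config n, s = config_widen s' & t = npos_of s'.
  move=> lt_t et; have [s' es'] := npos_ofP n t lt_t.
  by exists s' => //; apply: npos_of_inj; rewrite -et es'.
move es0: (npos_of s0) => u sr.
have {}es0 : u = npos_of (config_widen s0) by rewrite -es0.
case: sr es0 => {u U z} [u U0 t1 e1 lt_t1|u U0 t1 U1 t2 e1 e2 t1n lt_t2
   |u U0 t1 U1 t2 U2 t3 e1 e2 e3 t1n t2n lt_t3] eu.
- have [s1 et1 p1] := step _ _ _ _ e1 eu.
  have [s1' es1 ez] := last_in _ _ lt_t1 et1; exists s1' => //.
  (* The default of [nth] is the end of the run, so index [k.+1], just past the list, reads the last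
     configuration. *)
  have := @path_tr F q n D 0 (nth s1 [:: config_widen s0]) (nth 0 [:: U0]) s0 s1'.
  rewrite /rev /= !big_cons big_nil mulmx1; apply=> //; first by case.
  by case=> //= _; rewrite et1 in lt_t1; split=> // e; move: lt_t1; rewrite /= e ltnn.
- have [s1 et1 p1] := step _ _ _ _ e1 eu.
  have [s2 et2 p2] := step _ _ _ _ e2 et1.
  have [s2' es2 ez] := last_in _ _ lt_t2 et2; exists s2' => //.
  have := @path_tr F q n D 1 (nth s2 [:: config_widen s0; s1]) (nth 0 [:: U0; U1]) s0 s2'.
  rewrite /rev /= !big_cons big_nil mulmx1; apply=> //; first by case=> [|[]].
  rewrite et1 in t1n; rewrite et2 in lt_t2.
  by case=> [|[]] //= _; split=> // e; move: lt_t2; rewrite /= e ltnn.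
- have [s1 et1 p1] := step _ _ _ _ e1 eu.
  have [s2 et2 p2] := step _ _ _ _ e2 et1.
  have [s3 et3 p3] := step _ _ _ _ e3 et2.
  have [s3' es3 ez] := last_in _ _ lt_t3 et3; exists s3' => //.
  have := @path_tr F q n D 2 (nth s3 [:: config_widen s0; s1; s2])
    (nth 0 [:: U0; U1; U2]) s0 s3'.
  rewrite /rev /= !big_cons big_nil mulmx1 mulmxA; apply=> //; first by case=> [|[|[]]].
  rewrite et1 in t1n; rewrite et2 in t2n; rewrite et3 in lt_t3.
  by case=> [|[|[]]] //= _; split=> // e; move: lt_t3; rewrite /= e ltnn.
Qed.

(** * Linear maps given on basis vectors *)

Lemma linext_is_linear n m (f : config n -> 'I_q -> hspace F q m) :
  linear (fun v : hspace F q n => \sum_b (v b : F) *: f b.1 b.2).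
Proof.
move=> a u v; rewrite scaler_sumr -big_split; apply: eq_bigr => b _.
by rewrite /= !ffunE scalerDl scalerA.
Qed.

(** [lfunE] asks for a bundled linear function, whereas [linext] applies [linfun] to a bare one; the
    bundle is built here. *)
Lemma linextE n m (f : config n -> 'I_q -> hspace F q m) v :
  linext f v = \sum_b (v b : F) *: f b.1 b.2.
Proof.
pose L := GRing.isLinear.Build _ _ _ _ _ (linext_is_linear _ _ f).
pose g : {linear _ -> _} :=
  HB.pack (fun v : hspace F q n => \sum_b (v b : F) *: f b.1 b.2) L.
exact: (lfunE g v).
Qed.

Lemma linext_tens n m (f : config n -> 'I_q -> hspace F q m) s v :
  linext f (tens s v) = \sum_x v x ord0 *: f s x.
Proof.
rewrite linextE (eq_bigr (fun b => (tens s v (b.1, b.2) : F) *: f b.1 b.2)) => [|[]//].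
rewrite -(pair_bigA _ (fun a x => (tens s v (a, x) : F) *: f a x)) /=.
rewrite (bigD1 s) //= [X in _ + X]big1 ?addr0 => [|t ne_ts].
  by apply: eq_bigr => x _; rewrite ffunE /= eqxx.
by rewrite big1 // => x _; rewrite ffunE /= (negPf ne_ts) scale0r.
Qed.

Lemma linext_ket n m (f : config n -> 'I_q -> hspace F q m) s x :
  linext f (ket F s x) = f s x.
Proof.
rewrite linext_tens (bigD1 x) //= big1 => [|y ne_yx];
  rewrite !mxE eqxx ?addr0 ?scale1r //.
by rewrite (negPf ne_yx) scale0r.
Qed.

Lemma tens_sum n (s : config n) (v : 'cV[F]_q) :
  tens s v = \sum_x v x ord0 *: ket F s x.
Proof.
apply/ffunP => b; rewrite sum_ffunE ffunE; case: eqP => [eb|ne_b].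
  rewrite (bigD1 b.2) //= big1 => [|x ne_x]; rewrite !ffunE eb eqxx mxE !eqxx.
    by rewrite addr0 [RHS]mulr1.
  by rewrite eq_sym (negPf ne_x) scaler0.
by rewrite big1 // => x _; rewrite !ffunE; case: eqP => // _; rewrite scaler0.
Qed.

Lemma eq_on_kets n m (f g : 'Hom(hspace F q n, hspace F q m)) :
  (forall s x, f (ket F s x) = g (ket F s x)) -> f = g.
Proof.
move=> fg; apply/lfunP => u.
have -> : u = \sum_b (u b : F) *: ket F b.1 b.2.
  apply/ffunP => b; rewrite sum_ffunE (bigD1 b) //= big1 => [|c ne_cb].
    by rewrite addr0 !ffunE eqxx mxE !eqxx [RHS]mulr1.
  rewrite !ffunE; case: eqP => [e1|_]; last by rewrite scaler0.
  rewrite mxE; case: eqP => [e2|_]; last by rewrite scaler0.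
  by move: ne_cb; rewrite (surjective_pairing c) -e1 -e2 -surjective_pairing eqxx.
by rewrite !linear_sum; apply: eq_bigr => b _; rewrite !linearZ /= fg.
Qed.

Lemma lfun_tens n m (f : 'Hom(hspace F q n, hspace F q m)) s s' U :
  (forall x, f (ket F s x) = tens s' (U *m qket F x)) ->
  forall v, f (tens s v) = tens s' (U *m v).
Proof.
move=> fs v; rewrite tens_sum linear_sum.
rewrite (eq_bigr (fun x => v x ord0 *: tens s' (U *m qket F x))) => [|x _]; last first.
  by rewrite linearZ /= fs.
apply/ffunP => b; rewrite sum_ffunE ffunE.
case: eqP => [eb|ne]; last first.
  by rewrite big1 // => x _; rewrite !ffunE; case: eqP => // _; rewrite scaler0.
rewrite mxE; apply: eq_bigr => x _; rewrite !ffunE eb eqxx -colE mxE.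
by rewrite [LHS]mulrC.
Qed.

(** * The series of the trace on basis vectors *)

Lemma hproj0_tens n (s : config n.+1) (v : 'cV[F]_q) :
  hproj0 F q n (tens s v) = if (s.2 < n)%N then 0 else tens s v.
Proof.
rewrite linext_tens; case: ifP => _; last by rewrite -tens_sum.
by rewrite big1 // => x _; rewrite scaler0.
Qed.

Lemma hproj1_tens_ge n (s : config n.+1) (v : 'cV[F]_q) :
  (n <= s.2)%N -> hproj1 F q n (tens s v) = 0.
Proof.
move=> le_s; rewrite linext_tens big1 // => x _.
by rewrite insubN ?scaler0 // -leqNgt.
Qed.

Lemma hproj1_tens_widen n (s : config n) (v : 'cV[F]_q) :
  hproj1 F q n (tens (config_widen s) v) = tens s v.
Proof.
rewrite linext_tens tens_sum; apply: eq_bigr => x _; congr (_ *: _).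
by rewrite /= insubT.
Qed.

Lemma linext_tens_ket n m (h : config n -> config m) s (v : 'cV[F]_q) :
  linext (fun s x => ket F (h s) x) (tens s v) = tens (h s) v.
Proof. by rewrite linext_tens -tens_sum. Qed.

(** One factor of the series in [htrace], as a function on vectors. *)
Definition hbounce {n} (f : 'End(hspace F q n.+1)) (u : hspace F q n.+1) :=
  f (hproj0 F q n u).

(** Terms that kill every basis vector are zero maps, so the sum over all indices reduces to the
    indices below [N]. *)
Lemma htraceE n (f : 'End(hspace F q n.+1)) N u :
  (forall j s x, (N <= j)%N ->
     hproj1 F q n (iter j (hbounce f) (f (ket F (config_widen s) x))) = 0) ->
  htrace f u = \sum_(j < N) hproj1 F q n (iter j (hbounce f) (f (hincl F q n u))).
Proof.
move=> late0; rewrite /htrace.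
have termE j w : (hproj1 F q n \o iter j (fun g => (f \o hproj0 F q n) \o g) \1
    \o f \o hincl F q n)%VF w = hproj1 F q n (iter j (hbounce f) (f (hincl F q n w))).
  rewrite !comp_lfunE; congr (hproj1 F q n _).
  by elim: j => [|j IH]; rewrite /= ?id_lfunE // !comp_lfunE IH.
rewrite -(@fsbig_widen _ _ _ _ `I_N) //; last first.
  move=> j [_ /= /negP]; rewrite -leqNgt => le_Nj; apply: eq_on_kets => s x.
  by rewrite termE linext_ket late0 // lfunE.
rewrite -fsbig_ord sum_lfunE; apply: eq_bigr => j _; exact: termE.
Qed.

(** A vector on an untraced wire passes the final projection at once, and any further factor kills
    it through [hproj0]. *)
Lemma hbounce_exit n (f : 'End(hspace F q n.+1)) (s : config n) (v : 'cV[F]_q) j :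
  hproj1 F q n (iter j (hbounce f) (tens (config_widen s) v)) =
  if j == 0%N then tens s v else 0.
Proof.
case: j => [|j]; first exact: hproj1_tens_widen.
rewrite iterSr {2}/hbounce hproj0_tens /= ltn_ord linear0.
have -> : iter j (hbounce f) 0 = 0 by elim: j => //= j ->; rewrite /hbounce !linear0.
exact: linear0.
Qed.

(** On the traced wire the final projection gives 0; with at least one factor left, that factor
    performs a step and lowers the index by one. *)
Lemma hbounce_stay n (f : 'End(hspace F q n.+1)) (t t' : config n.+1) U :
  t.2 = n :> nat -> (forall v, f (tens t v) = tens t' (U *m v)) ->
  forall j v, hproj1 F q n (iter j (hbounce f) (tens t v)) =
  if j is j'.+1 then hproj1 F q n (iter j' (hbounce f) (tens t' (U *m v))) else 0.
Proof.
move=> tn ft [|j] v; first by rewrite /= hproj1_tens_ge // tn.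
by rewrite iterSr {2}/hbounce hproj0_tens tn ltnn ft.
Qed.

(** Exactly one term of the series sees a given run: its index [k] is the number of visits to the
    traced wire. *)
Lemma hbounce_short_run n (D : term F q n.+1) (f : 'End(hspace F q n.+1)) s U s' :
  (forall t V t', ev _ D (npos_of t) V (npos_of t') ->
     forall v, f (tens t v) = tens t' (V *m v)) ->
  short_run (ev _ D) n (npos_of s) U (npos_of s') ->
  exists2 k, (k < 3)%N & forall j v,
    hproj1 F q n (iter j (hbounce f) (f (tens (config_widen s) v))) =
    if j == k then tens s' (U *m v) else 0.
Proof.
move=> fD; move es: (npos_of s) => u; move es': (npos_of s') => u' sr.
have {}es : npos_of (config_widen s) = u by [].
have {}es' : npos_of (config_widen s') = u' by [].
have mid t V t' : ev _ D t V t' -> exists z : config n.+1, t' = npos_of z.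
  by case/ev_bounded => _; exact: npos_ofP.
case: sr es es' => {u U u'} [u U0 t1 e1 _|u U0 t1 U1 t2 e1 e2 t1n _
   |u U0 t1 U1 t2 U2 t3 e1 e2 e3 t1n t2n _] eu et.
- exists 0%N => // j v; rewrite -eu -et in e1.
  by rewrite (fD _ _ _ e1) hbounce_exit.
- have [z1 ez1] := mid _ _ _ e1.
  exists 1%N => // j v; rewrite -eu ez1 in e1; rewrite ez1 -et in e2.
  rewrite ez1 in t1n.
  rewrite (fD _ _ _ e1) (hbounce_stay _ _ _ _ _ t1n (fD _ _ _ e2)).
  by case: j => // j; rewrite hbounce_exit mulmxA.
- have [z1 ez1] := mid _ _ _ e1; have [z2 ez2] := mid _ _ _ e2.
  exists 2%N => // j v; rewrite -eu ez1 in e1; rewrite ez1 ez2 in e2.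
  rewrite ez2 -et in e3; rewrite ez1 in t1n; rewrite ez2 in t2n.
  rewrite (fD _ _ _ e1) (hbounce_stay _ _ _ _ _ t1n (fD _ _ _ e2)).
  case: j => // j; rewrite (hbounce_stay _ _ _ _ _ t2n (fD _ _ _ e3)).
  by case: j => // j; rewrite hbounce_exit !mulmxA.
Qed.

(** * Denotations computed from paths *)

(** An arbitrary [v] replaces the basis vector so that, in a composition, the output of one term can
    be fed to the next. *)
Lemma tdenote_tens n (D : term F q n) s U s' :
  ev _ D (npos_of s) U (npos_of s') ->
  forall v, tdenote D (tens s v) = tens s' (U *m v).
Proof.
elim: D s U s' => {n} /=.
- by move=> [c []].
- by move=> s U s' [_ -> /npos_of_inj ->] v; rewrite id_lfunE mul1mx.
- move=> s U s' [_ -> es] v; rewrite mul1mx linext_tens_ket; congr tens.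
  exact: npos_of_inj.
- move=> s U s' [_ -> es] v; rewrite mul1mx linext_tens_ket; congr tens.
  by apply: npos_of_inj; rewrite es.
- move=> [c p] U s' [_ -> es] v; rewrite mul1mx linext_tens_ket; congr tens.
  by apply: npos_of_inj; rewrite es; case: c {es}.
- move=> U s V s' [_ -> /npos_of_inj ->]; apply: lfun_tens => x.
  by rewrite linext_ket.
- move=> n D2 IH2 D1 IH1 s W s' [t [U [V [e1 e2 ->]]]] v.
  have [_ lt_t] := ev_bounded _ _ _ _ _ e1; have [t' et] := npos_ofP _ _ lt_t.
  rewrite et in e1 e2.
  by rewrite comp_lfunE (IH1 _ _ _ e1) (IH2 _ _ _ e2) mulmxA.
- move=> n m D1 IH1 D2 IH2 [c p] U [c' p'] e; apply: lfun_tens => x.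
  rewrite linext_ket /=; case: (split_ordP p) e => r -> e.
    have lt_r : ((npos_of (c, lshift m r)).2 < n)%N := ltn_ord r.
    have {}e := rpar_ltE _ _ _ _ _ _ lt_r e.
    have [_ /= lt_p'] := ev_bounded _ _ _ _ _ e.
    rewrite (IH1 (c, r) _ (c', Ordinal lt_p') e) linext_tens_ket.
    by congr tens; congr (_, _); exact: val_inj.
  have ge_r : (n <= (npos_of (c, rshift n r)).2)%N := leq_addr r n.
  have [t [t' [et et' {}e]]] := rpar_geE _ _ _ _ _ _ (ev_bounded _ D1) ge_r e.
  rewrite -[npos_of _]/(shift n (npos_of (c, r))) in et.
  rewrite -(shift_inj _ _ _ et) in e.
  have [_ lt_t'] := ev_bounded _ _ _ _ _ e; have [z ez] := npos_ofP _ _ lt_t'.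
  rewrite ez in e et'.
  rewrite (IH2 _ _ _ e) linext_tens_ket.
  by congr tens; exact: npos_of_inj.
move=> n D IH s U s' /ev_tr_short/(hbounce_short_run _ _ _ _ _ _ IH)[k lt_k3 runE] v.
rewrite (@htraceE _ _ 3) => [|j t x le3j].
  rewrite (bigD1 (Ordinal lt_k3)) //= linext_tens_ket runE eqxx big1 ?addr0 // => j ne_jk.
  by rewrite runE; case: eqP => // e; case/eqP: ne_jk; exact: val_inj.
(* Truncation needs the late terms to vanish on every basis vector, so a short run is produced from
   each start [t], not only from [s]. *)
have [V [t' sr]] := short_run_total _ _ (npos_of t) (ev_bounded _ D)
  (ev_total _ D) (ev_inj _ D) (ltn_ord t.2).
have [z ez] := npos_ofP _ _ (run_lt _ _ _ _ _ (short_run_run _ _ _ _ _ sr)).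
rewrite ez in sr; have [l lt_l3 ->] := hbounce_short_run _ _ _ _ _ _ IH sr.
by case: eqP => // e; move: lt_l3; rewrite -e ltnNge le3j.
Qed.

(** * Passage from terms to diagrams *)

(** Congruent terms have one and the same relation, so its determinism also gives independence of
    the representative. *)
Lemma pbs_path_det n (D D' : term F q n) s U s' V t' : scong D D' ->
  pbs_path D s U s' -> pbs_path D' s V t' -> U = V /\ s' = t'.
Proof.
move=> /ev_scong DD' /pbs_path_ev + /pbs_path_ev; rewrite DD' => e1 e2.
by have [-> /npos_of_inj] := ev_det _ _ _ _ _ _ _ e1 e2.
Qed.

Lemma pbs_path_total n (D : term F q n) s : exists U s', pbs_path D s U s'.
Proof.
have [U [z e]] := ev_total _ D (npos_of s) (ltn_ord s.2).
by have [s' _ p] := ev_pbs_path _ _ _ _ _ e; exists U, s'.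
Qed.

Lemma tdenote_path n (D : term F q n) s U s' x : pbs_path D s U s' ->
  tdenote D (ket F s x) = tens s' (U *m qket F x).
Proof. by move=> /pbs_path_ev/tdenote_tens; apply. Qed.

(** No axiom is checked on linear maps: paths determine the denotation on basis vectors, and
    congruent terms have the same paths. *)
Lemma tdenote_scong n (D D' : term F q n) : scong D D' -> tdenote D = tdenote D'.
Proof.
move=> DD'; apply: eq_on_kets => s x.
have [U [s' p]] := pbs_path_total _ D s; have [V [t' p']] := pbs_path_total _ D' s.
have [eU es] := pbs_path_det _ _ _ _ _ _ _ _ DD' p p'.
by rewrite (tdenote_path _ _ _ _ _ _ p) (tdenote_path _ _ _ _ _ _ p') eU es.
Qed.

Lemma pi_scong n (t t' : term F q n) :
  \pi_(diagram F q n) t = \pi_(diagram F q n) t' -> scong t t'.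
Proof. by move=> /eqquotP/asboolP. Qed.

Lemma dpath_det n (D : diagram F q n) s U s' V t' :
  dpath D s U s' -> dpath D s V t' -> U = V /\ s' = t'.
Proof.
move=> [t tD p] [t1 t1D p']; apply: pbs_path_det p p'.
by apply: pi_scong; rewrite tD t1D.
Qed.

(** Totality rules out the default value of [xget]. *)
Lemma dpath_resultP n (D : diagram F q n) s :
  dpath D s (dmatrix D s) (tau D s).
Proof.
have [U [s' p]] := pbs_path_total _ (repr D) s.
rewrite /dmatrix /tau /dpath_result; case: xgetP => [r _ //|/(_ (s', U)) []].
by exists (repr D) => //; exact: reprK.
Qed.

End PathsAndDenotations.

Theorem theorem11 (R : realType) (q : nat) (hq : (1 <= q)%N) (n : nat)
    (D : diagram R[i] q n) :
  (forall t : term R[i] q n, \pi_(diagram R[i] q n) t = D ->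
     tdenote t = denote D) /\
  forall (c : dir) (p : 'I_n),
    (dpath D (c, p) (dmatrix D (c, p)) (tau D (c, p)) /\
     (forall (U : 'M[R[i]]_q) (s : config n), dpath D (c, p) U s ->
        U = dmatrix D (c, p) /\ s = tau D (c, p))) /\
    (forall x : 'I_q,
       denote D (ket R[i] (c, p) x) =
       tens (tau D (c, p)) (dmatrix D (c, p) *m qket R[i] x)).
Proof.
have denoteE t : \pi_(diagram R[i] q n) t = D -> tdenote t = denote D.
  by move=> tD; apply: tdenote_scong; apply: pi_scong; rewrite reprK.
split=> // c p; have path_D := dpath_resultP _ D (c, p).
split; first by split=> // U s path_s; exact: dpath_det path_s path_D.
(* The term carrying the path may differ from [repr D], so the denotation is first moved to that
   term. *)
by move=> x; have [t tD pt] := path_D; rewrite -(denoteE t tD); exact: tdenote_path.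
Qed.
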